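(* For every $n\ge1$ there is a bijection $\phi^{(D)}_C:\mathcal{CUD}^{(D)}_n\to\mathcal{T}^*_n$ which, for each $1\le k\le n$, restricts to a bijection from $\mathcal{CUD}^{(D)}_{n,k}$ onto $\mathcal{T}^*_{n,k}$.
   Context: A signed permutation of $[n]$ is a bijection $\sigma$ of $[\pm n]$ with $\sigma(-i)=-\sigma(i)$; $\bar a=-a$; cycles on $[\pm n]$ are written $(c_1,\dots,c_r)$ with $\sigma(c_j)=c_{j+1}$, $\sigma(c_r)=c_1$; if $C$ is a cycle so is $-C$. $\mathcal{CUD}^{(D)}_n$: signed permutations with exactly one cycle $C=-C$, this cycle being $(k,\bar k)$ for some $k\in[n]$, all other cycles in pairs $\{C,-C\}$ with $C\ne -C$, such that, choosing from each pair the cycle in which the entry of smallest absolute value is positive, written starting with that entry, and ordering them as $(a_{1,1},\dots)\cdots(a_{m-1,1},\dots)$ with $a_{1,1}<\dots<a_{m-1,1}$, we have $a_{m-1,1}<k$ and each cycle satisfies $|a_{i,1}|<|a_{i,2}|>|a_{i,3}|<\cdots$. $\mathcal{CUD}^{(D)}_{n,k}$: those whose special cycle is $(k,\bar k)$. $\mathcal{T}_n$ is the set of complete increasing binary trees with $n$ labelled nodes: plane rooted trees in which every node is either a leaf or has exactly two ordered children (left, right), exactly $n$ nodes carry labels, bijectively from $[n]$, every non-leaf node is labelled (leaves may be labelled or unlabelled; unlabelled leaves are called empty), and labels increase along every path from the root. The rightmost path is $(v_1,\dots,v_d)$, $v_1$ the root, $v_{i+1}$ the right child of $v_i$, $v_d$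 a leaf. $\mathcal{T}^\circ_n$ ($\mathcal{T}^*_n$): trees whose rightmost leaf $v_d$ is empty (labelled). The rightmost label is the label of $v_{d-1}$ for $\tau\in\mathcal{T}^\circ_n$ and of $v_d$ for $\tau\in\mathcal{T}^*_n$. $\mathcal{T}^\circ_{n,k}$, $\mathcal{T}^*_{n,k}$: those with rightmost label $k$. *)

(* Defs.v *)
From mathcomp Require Import all_boot all_fingroup.

Set Implicit Arguments.
Unset Strict Implicit.
Unset Printing Implicit Defensive.

Definition bij_onto (A B : Type) (P : pred A) (Q : pred B) (f : A -> B) : Prop :=
  [/\ forall x, P x -> Q (f x),
      {in P &, injective f}
    & forall y, Q y -> exists2 x, P x & f x = y].

(* The set [+-n]: (i, false) stands for i + 1 and (i, true) for -(i + 1). *)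
Definition letter (n : nat) : finType := ('I_n * bool)%type.

Section SignedPermutations.
Variable n : nat.
Implicit Types (x : letter n) (i : 'I_n) (C : {set letter n}).
Implicit Types (s : {perm letter n}) (k : nat).

Definition pos i : letter n := (i, false).
Definition bar x : letter n := (x.1, ~~ x.2).
Definition absl x : nat := x.1.+1.
Definition bar_set C : {set letter n} := [set bar x | x in C].

Definition signed_perm s := [forall x, s (bar x) == bar (s x)].

(* A cycle of s is determined by its set of entries, so cycles are identified
   with the elements of [porbits s]; [cycle_from s x] is the cycle of x written
   as a sequence starting with x. *)
Definition cycle_from s x : seq (letter n) := traject s x #|porbit s x|.

Definition special_cycle s k :=
  [exists i, (absl (pos i) == k) &&
    ([set C in porbits s | C == bar_set C] == [set [set pos i; bar (pos i)]])].

Definition is_first s x :=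
  (porbit s x != bar_set (porbit s x)) &&
  [forall y in porbit s x, absl x <= absl y].

(* The entries a_{1,1} < ... < a_{m-1,1}; [enum 'I_n] is increasing. *)
Definition firsts s : seq (letter n) :=
  [seq x <- [seq pos i | i <- enum 'I_n] | is_first s x].

Definition chosen_cycles s : seq (seq (letter n)) :=
  [seq cycle_from s x | x <- firsts s].

(* x_1 < x_2 > x_3 < ... if [up], and x_1 > x_2 < x_3 > ... otherwise. *)
Fixpoint alternating (up : bool) (w : seq nat) : bool :=
  if w is x :: w' then
    (if w' is y :: _ then if up then x < y else y < x else true) &&
    alternating (~~ up) w'
  else true.

(* The default 0 of [last] makes the bound vacuous when the special cycle is
   the only one. *)
Definition is_CUDD_at k s :=
  [&& signed_perm s, special_cycle s k,
      last 0 [seq absl x | x <- firsts s] < k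
    & all (fun c => alternating true [seq absl x | x <- c]) (chosen_cycles s)].

Definition is_CUDD s := [exists i : 'I_n, is_CUDD_at i.+1 s].

Definition CUDD := {s : {perm letter n} | is_CUDD s}.

End SignedPermutations.

Inductive bintree : Type :=
  | Empty
  | Leaf of nat
  | Node of nat & bintree & bintree.

Definition root_label (t : bintree) : option nat :=
  match t with Empty => None | Leaf a => Some a | Node a _ _ => Some a end.

Fixpoint labels (t : bintree) : seq nat :=
  match t with
  | Empty => [::]
  | Leaf a => [:: a]
  | Node a l r => a :: labels l ++ labels r
  end.

(* The label sequences of the paths from the root to the leaves. *)
Fixpoint branches (t : bintree) : seq (seq nat) :=
  match t with
  | Empty => [:: [::]]
  | Leaf a => [:: [:: a]]
  | Node a l r => [seq a :: p | p <- branches l ++ branches r]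
  end.

Definition increasing_tree (t : bintree) := all (sorted ltn) (branches t).

(* Nodes are represented by the subtrees they root. *)
Fixpoint rightmost_path (t : bintree) : seq bintree :=
  t :: (if t is Node _ _ r then rightmost_path r else [::]).

Definition rightmost_leaf (t : bintree) : bintree := last t (rightmost_path t).

Definition is_T (n : nat) (t : bintree) :=
  perm_eq (labels t) (iota 1 n) && increasing_tree t.

Definition is_Tstar (n : nat) (t : bintree) :=
  is_T n t && (root_label (rightmost_leaf t) != None).

Definition is_Tstar_at (n k : nat) (t : bintree) :=
  is_Tstar n t && (root_label (rightmost_leaf t) == Some k).

Definition Tstar (n : nat) := {t : bintree | is_Tstar n t}.

(* Main.v *)
(* Both families are in bijection with the same lists of signed words.

   A signed permutation with special cycle (k, -k) is determined by its chosen
   cycles.  A tree whose rightmost leaf is labelled k is determined by its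
   rightmost path a_1 < ... < a_m < k together with the left subtrees hanging
   off it.  It remains to match the trees on a set S of labels with the signed
   words w on S such that |w_1| > |w_2| < |w_3| > ..., which makes (a_i, w) a
   cycle of the required shape when a_i < min S.

   If m = min S, then both sides of m in a word that alternates in either
   direction are words of the same kind, once the left side is reversed; the
   parity of the length of the left side tells in which direction the word
   alternates.  A tree with root m thus yields an alternating word with no sign
   at m.  If its direction is wrong, the order on S is reversed; the sign of m
   records whether this happened (if S = {m}, it tells a labelled leaf from a
   node with two empty children). *)
Require Import Defs.
From mathcomp Require Import all_boot all_fingroup zify.

Set Implicit Arguments.
Unset Strict Implicit.
Unset Printing Implicit Defensive.

(** * Alternating words *)

(** The letter [x] is kept in both factors, so no comparison is lost; the parity of [size u] gives
    the direction in which the second factor starts. *)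
Lemma alternating_cat b u x v :
  alternating b (u ++ x :: v) =
  alternating b (rcons u x) && alternating (b (+) odd (size u)) (x :: v).
Proof.
elim: u b => [|y u IHu] b; first by rewrite addbF.
rewrite cat_cons rcons_cons [LHS]/= [alternating b (y :: _)]/= IHu addNb /= addbN.
by case: u {IHu} => [|z u]; rewrite /= ?andbT ?andbA.
Qed.

Lemma alternating_rcons b w x y :
  alternating b (rcons (rcons w x) y) =
  alternating b (rcons w x) && (if b (+) odd (size w) then x < y else y < x).
Proof. by rewrite -cats1 cat_rcons alternating_cat /= !andbT. Qed.

(** Reversal inverts every comparison and starts with the last one, which has the direction of the
    first one exactly when the length is even. *)
Lemma alternating_rev b w :
  alternating b (rev w) = alternating (~~ b (+) odd (size w)) w.
Proof.
elim: w => [|x w IHw] //; rewrite rev_cons.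
case: w IHw => [|y w] IHw //.
rewrite rev_cons alternating_rcons -rev_cons {}IHw size_rev andbC /=.
by case: b; case: (odd (size w)).
Qed.

Lemma alternating_min a w b :
  all (ltn a) w ->
  alternating b (a :: w) = ((w == [::]) || b) && alternating false w.
Proof. by case: w => [|x w] //= /andP[ax _]; case: b; rewrite ?ax // ltnNge ltnW. Qed.

(** Read outward from the minimum [a], each side begins with an ascent, so what follows [a] must
    begin with a descent. The distance of [a] from the left end then forces [b], except in a
    one-letter word, which alternates both ways. *)
Lemma alternating_pivot b u a v :
  all (ltn a) u -> all (ltn a) v ->
  alternating b (rev u ++ a :: v) =
  [&& (u ++ v == [::]) || (b == ~~ odd (size u)),
      alternating false u & alternating false v].
Proof.
move=> au av; rewrite alternating_cat -rev_cons alternating_rev size_rev /=.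
rewrite -/(alternating _ (a :: u)) -/(alternating _ (a :: v)).
have -> : ~~ b (+) ~~ odd (size u) = b (+) odd (size u) by case: b; case: odd.
rewrite !alternating_min //.
have -> : (b == ~~ odd (size u)) = b (+) odd (size u) by case: b; case: odd.
by case: u {au} => [|x u]; case: v {av} => [|y v]; case: (_ (+) _);
   rewrite /= ?andbF.
Qed.

Lemma alternating_antitone (T : eqType) (f g : T -> nat) b w :
  {in w &, forall x y, (g x < g y) = (f y < f x)} ->
  alternating b (map g w) = alternating (~~ b) (map f w).
Proof.
elim: w b => [|x w IHw] b // gf /=.
rewrite (IHw (~~ b)); last by move=> y z yw zw; apply: gf; rewrite inE ?yw ?zw orbT.
case: w gf {IHw} => [|y w] //= gf.
by rewrite !gf ?inE ?eqxx ?orbT //; case: b.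
Qed.

(** * Reversing the order on the letters of a signed word *)

Definition code (x : nat * bool) : nat := x.1.*2 + x.2.

(** The code compares absolute values first and breaks ties by sign. Injectivity makes [code_le]
    antisymmetric, so the sorted list of letters depends only on the multiset of letters. *)
Lemma code_inj : injective code.
Proof. by move=> [a b] [c d]; rewrite /code /=; case: b; case: d => H; congr (_, _); lia. Qed.

Definition code_le : rel (nat * bool) := relpre code leq.

Lemma code_le_trans : transitive code_le.
Proof. by move=> y x z; apply: leq_trans. Qed.

Lemma code_le_total : total code_le.
Proof. by move=> x y; apply: leq_total. Qed.

Lemma code_le_anti : antisymmetric code_le.
Proof. by move=> x y /anti_leq/code_inj. Qed.

Notation abs_word w := [seq x.1 | x <- w].

Section Mirror.
Variable T : eqType.
Implicit Types (x : T) (s : seq T).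

(** On a sorted duplicate-free list this is the order-reversing involution; a letter outside [s] is
    fixed through the default of [nth]. *)
Definition mirror s x := nth x (rev s) (index x s).

Lemma map_mirror s : uniq s -> map (mirror s) s = rev s.
Proof.
move=> us; case: s us => [|x0 s] // us; set t := x0 :: s in us *.
apply: (@eq_from_nth _ x0); rewrite ?size_map ?size_rev // => i it.
rewrite (nth_map x0) // /mirror index_uniq //.
by apply: set_nth_default; rewrite size_rev.
Qed.

Lemma mirrorK s : uniq s -> {in s, cancel (mirror s) (mirror s)}.
Proof.
move=> us x xs; have xi : index x s < size s by rewrite index_mem.
have xi' : size s - (index x s).+1 < size s by lia.
have ix : index (mirror s x) s = size s - (index x s).+1.
  by rewrite /mirror nth_rev // index_uniq.
rewrite {1}/mirror ix nth_rev // subnSK // subKn; last by lia.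
by rewrite nth_index.
Qed.

End Mirror.

Definition letters (w : seq (nat * bool)) := sort code_le w.

Lemma mem_letters w : letters w =i w.
Proof. exact: mem_sort. Qed.

Lemma letters_uniq w : uniq (letters w) = uniq w.
Proof. exact: sort_uniq. Qed.

Lemma letters_abs_sorted w : uniq (abs_word w) -> sorted ltn (abs_word (letters w)).
Proof.
move=> uw; rewrite ltn_sorted_uniq_leq.
have -> : uniq (abs_word (letters w)).
  by rewrite (perm_uniq (perm_map _ (permEl (perm_sort _ _)))).
rewrite sorted_map; apply: sub_sorted (sort_sorted code_le_total w).
by move=> [a b] [c d]; rewrite /code_le /code /=; case: b; case: d => /=; lia.
Qed.

(** With distinct absolute values, comparing two letters amounts to comparing their indices in
    [letters w], and [mirror] reverses indices. *)
Lemma mirror_antitone w : uniq (abs_word w) ->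
  {in w &, forall x y,
    ((mirror (letters w) x).1 < (mirror (letters w) y).1) = (y.1 < x.1)}.
Proof.
move=> uw x y; rewrite -!(mem_letters w) => xw yw.
have sw := letters_abs_sorted uw.
have nthE z i j : i < size (letters w) -> j < size (letters w) ->
    ((nth z (letters w) i).1 < (nth z (letters w) j).1) = (i < j).
  move=> iw jw; rewrite -!(nth_map z 0 fst) //.
  have H := sorted_ltn_nth ltn_trans 0 sw; rewrite size_map in H.
  case: (ltngtP i j) => [ij|ji|->]; rewrite ?ltnn //; first exact: H.
  by apply/negbTE; rewrite -leqNgt ltnW // H.
have ix : index x (letters w) < size (letters w) by rewrite index_mem.
have iy : index y (letters w) < size (letters w) by rewrite index_mem.
have sub_lt i : i < size (letters w) ->
    size (letters w) - i.+1 < size (letters w) by lia.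
rewrite /mirror (set_nth_default x y) ?size_rev // !nth_rev // nthE ?sub_lt //.
have -> : (y.1 < x.1) = (index y (letters w) < index x (letters w)).
  by rewrite -[RHS](nthE x) // !nth_index.
have is_lt i j : i < size (letters w) -> j < size (letters w) ->
    (size (letters w) - i.+1 < size (letters w) - j.+1) = (j < i) by lia.
exact: is_lt.
Qed.

(** Whole signed letters are exchanged, so each absolute value keeps its sign. This is why the sign
    of the minimum can still be read after a flip. *)
Definition flip w := map (mirror (letters w)) w.

Lemma flip_perm w : uniq w -> perm_eq (flip w) w.
Proof.
move=> uw; have wl : perm_eq (letters w) w by apply/permEl/perm_sort.
apply: (perm_trans (perm_map _ _ : perm_eq _ (map (mirror (letters w)) (letters w)))).
  by rewrite perm_sym.
by rewrite map_mirror ?letters_uniq // (perm_trans _ wl) // perm_rev.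
Qed.

Lemma letters_perm u v : perm_eq u v -> letters u = letters v.
Proof. by move/(perm_sortP code_le_total code_le_trans code_le_anti). Qed.

(** A flipped word has the same sorted letters, hence the same involution is applied twice. *)
Lemma flipK w : uniq w -> flip (flip w) = w.
Proof.
move=> uw; rewrite {1}/flip (letters_perm (flip_perm uw)) /flip -map_comp.
apply: map_id_in => x xw /=.
by rewrite mirrorK ?letters_uniq ?mem_letters.
Qed.

Lemma flip_alternating b w : uniq (abs_word w) ->
  alternating b (abs_word (flip w)) = alternating (~~ b) (abs_word w).
Proof.
move=> uw; rewrite /flip -map_comp; apply: alternating_antitone.
by move=> x y xw yw /=; rewrite mirror_antitone.
Qed.

(** * Trees as words *)

(* The sign of the root is redundant in the signed word read off a tree in
   inorder: there it tells whether the word has been order-reversed. *)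
Fixpoint tree_word (t : bintree) : seq (nat * bool) :=
  match t with
  | Empty => [::]
  | Leaf a => [:: (a, false)]
  | Node a l r =>
      let u := tree_word l in
      let w := rev u ++ (a, ~~ odd (size u)) :: tree_word r in
      if odd (size u) then w else flip w
  end.

Lemma branches_neq0 t : branches t != [::].
Proof. by elim: t => //= a l IHl r _; case: (branches l) IHl. Qed.

(** Every label lies on a branch, because even an empty subtree contributes one branch; the root
    label would otherwise be lost. *)
Lemma all_labels P t : all P (labels t) = all (all P) (branches t).
Proof.
elim: t => [|a|a l IHl r IHr] /=; rewrite ?andbT //.
rewrite all_cat IHl IHr -all_cat all_map.
have : branches l ++ branches r != [::] by case: (branches l) (branches_neq0 l).
elim: (_ ++ _) => //= p s IHs _.
case: s IHs => [|q s] IHs; first by rewrite !andbT.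
by rewrite -IHs //; case: (P a); rewrite ?andbF.
Qed.

Lemma increasing_tree_node a l r :
  increasing_tree (Node a l r) =
  [&& all (ltn a) (labels l ++ labels r), increasing_tree l & increasing_tree r].
Proof.
rewrite /increasing_tree /= all_map [all (ltn a) _]all_cat !all_labels -!all_cat.
rewrite -all_predI; apply: eq_all => p /=.
by rewrite path_sortedE //; apply: ltn_trans.
Qed.

(** Unlike [is_T], this leaves the label set free, so subtrees inherit it and inductions go
    through. *)
Definition good_tree t := increasing_tree t && uniq (labels t).

Lemma good_node a l r : good_tree (Node a l r) =
  [&& all (ltn a) (labels l), all (ltn a) (labels r), good_tree l, good_tree r
    & uniq (labels l ++ labels r)].
Proof.
rewrite /good_tree increasing_tree_node /= all_cat cat_uniq.
apply/idP/idP; first by case/andP=> /and3P[/andP[-> ->] -> ->] /and4P[_ -> -> ->].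
case/and5P=> al ar /andP[-> ->] /andP[-> ->] /and3P[_ -> _]; rewrite al ar !andbT /=.
rewrite mem_cat negb_or; apply/andP; split; apply/negP=> H.
  by have := allP al _ H; rewrite /= ltnn.
by have := allP ar _ H; rewrite /= ltnn.
Qed.

Definition inorder l a r : seq (nat * bool) :=
  rev (tree_word l) ++ (a, ~~ odd (size (tree_word l))) :: tree_word r.

Lemma tree_word_nodeE a l r : tree_word (Node a l r) =
  if odd (size (tree_word l)) then inorder l a r else flip (inorder l a r).
Proof. by []. Qed.

Lemma tree_word_labels t :
  good_tree t -> perm_eq (abs_word (tree_word t)) (labels t).
Proof.
elim: t => [|a|a l IHl r IHr] // gt.
move: (gt); rewrite good_node => /and5P[_ _ gl gr _].
have pinorder : perm_eq (abs_word (inorder l a r)) (labels (Node a l r)).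
  rewrite map_cat map_rev /= -cat1s perm_catCA /= perm_cons.
  by rewrite perm_cat ?IHr // perm_rev IHl.
rewrite tree_word_nodeE; case: ifP => // _; apply: perm_trans (pinorder).
apply/perm_map/flip_perm/(@map_uniq _ _ fst).
by rewrite (perm_uniq pinorder); case/andP: gt.
Qed.

Lemma all_tree_word P t :
  good_tree t -> all P (abs_word (tree_word t)) = all P (labels t).
Proof. by move=> gt; apply/perm_all/tree_word_labels. Qed.

Lemma inorder_labels a l r : good_tree (Node a l r) ->
  perm_eq (abs_word (inorder l a r)) (labels (Node a l r)).
Proof.
rewrite good_node => /and5P[al ar gl gr ulr].
rewrite map_cat map_rev /= -cat1s perm_catCA /= perm_cons.
by rewrite perm_cat ?tree_word_labels // perm_rev tree_word_labels.
Qed.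

Lemma inorder_uniq a l r : good_tree (Node a l r) -> uniq (abs_word (inorder l a r)).
Proof. by move=> gt; rewrite (perm_uniq (inorder_labels gt)); case/andP: gt. Qed.

Lemma perm_tree_word_inorder a l r : good_tree (Node a l r) ->
  perm_eq (tree_word (Node a l r)) (inorder l a r).
Proof.
move=> /inorder_uniq/map_uniq u; rewrite tree_word_nodeE; case: ifP => // _.
exact: flip_perm.
Qed.

Lemma tree_word_alternating t :
  good_tree t -> alternating false (abs_word (tree_word t)).
Proof.
elim: t => [|a|a l IHl r IHr] // gt; have ui := inorder_uniq gt.
move: gt; rewrite good_node => /and5P[al ar gl gr ulr].
(* The direction of the inorder word is dictated by its minimum [a]; it is the wrong one exactly
   when [tree_word] applies [flip]. *)
have alt : alternating (~~ odd (size (tree_word l))) (abs_word (inorder l a r)).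
  rewrite map_cat map_rev alternating_pivot ?all_tree_word //.
  by rewrite size_map eqxx orbT IHl // IHr.
rewrite tree_word_nodeE; case: ifP alt => [//|_ alt].
by rewrite flip_alternating.
Qed.

Lemma min_unique a b (s t : seq nat) :
  perm_eq (a :: s) (b :: t) -> all (ltn a) s -> all (ltn b) t -> a = b.
Proof.
move=> st /allP las /allP lbt; apply/eqP; apply: contraT => ab.
have : a \in b :: t by rewrite -(perm_mem st) mem_head.
have : b \in a :: s by rewrite (perm_mem st) mem_head.
rewrite !inE (negPf ab) eq_sym (negPf ab) /= => /las /= H /lbt /=.
by rewrite ltnNge ltnW.
Qed.

Lemma abs_inj (w : seq (nat * bool)) x y : uniq (abs_word w) -> x \in w -> y \in w -> x.1 = y.1 -> x = y.
Proof.
elim: w => //= z w IHw /andP[zw uw]; rewrite !inE.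
case/predU1P=> [->|xw] /predU1P[->|yw] // e; last exact: IHw.
- by case/negP: zw; rewrite e map_f.
- by case/negP: zw; rewrite -e map_f.
Qed.

(** A node with a one-letter word has an empty left word, hence sign [true] at its root; this
    separates it from a leaf. *)
Lemma tree_word_leaf a t : good_tree t -> tree_word t = [:: (a, false)] -> t = Leaf a.
Proof.
case: t => [|b|b l r] // gt; first by case=> ->.
move=> e; have := perm_tree_word_inorder gt; rewrite e perm_sym.
move/perm_small_eq => /(_ isT); rewrite /inorder; case: (tree_word l) => [|x s] /=; first by case.
by move/(congr1 size); rewrite size_cat size_rev /= addnS.
Qed.

(** The minimum of the word is the root label, and its sign tells whether the word was flipped.
    Undoing the flip and cutting at the root gives back the words of both subtrees. *)
Lemma tree_word_inj t1 t2 :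
  good_tree t1 -> good_tree t2 -> tree_word t1 = tree_word t2 -> t1 = t2.
Proof.
elim: t1 t2 => [|a|a l IHl r IHr] t2 g1 g2 e.
- case: t2 g2 e => [|b|b l r] // g2 e.
  by have := perm_tree_word_inorder g2; rewrite -e => /perm_size; rewrite size_cat addnS.
- by rewrite (tree_word_leaf g2 (esym e)).
case: t2 g2 e => [|b|b l2 r2] g2 e.
- by have := perm_tree_word_inorder g1; rewrite e => /perm_size; rewrite size_cat addnS.
- by rewrite (tree_word_leaf g1 e).
have p1 := perm_tree_word_inorder g1; have p2 := perm_tree_word_inorder g2.
have ui1 := inorder_uniq g1; have ui2 := inorder_uniq g2.
have p12 : perm_eq (inorder l a r) (inorder l2 b r2).
  by rewrite perm_sym in p1; apply: perm_trans p1 _; rewrite e.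
have plab : perm_eq (labels (Node a l r)) (labels (Node b l2 r2)).
  apply: perm_trans (inorder_labels g2); rewrite perm_sym.
  by apply: perm_trans (inorder_labels g1); apply: perm_map; rewrite perm_sym.
move: (g1) (g2); rewrite !good_node.
move=> /and5P[al1 ar1 gl1 gr1 _] /and5P[al2 ar2 gl2 gr2 _].
have ab : a = b by apply: min_unique plab _ _; rewrite all_cat ?al1 ?al2.
rewrite -{b}ab in e g2 p2 ui2 p12 plab al2 ar2 *.
have [odd12] : (a, ~~ odd (size (tree_word l))) = (a, ~~ odd (size (tree_word l2))).
  apply: (abs_inj ui2) => //; last by rewrite mem_cat mem_head orbT.
  by rewrite -(perm_mem p12) mem_cat mem_head orbT.
have ii : inorder l a r = inorder l2 a r2.
  move: e; rewrite !tree_word_nodeE -(negbK (odd (size (tree_word l)))) odd12 negbK.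
  case: ifP => // _ /(congr1 flip).
  by rewrite !flipK // (map_uniq ui1, map_uniq ui2).
(* The root letter occurs only once, so there is only one place to cut. *)
have root_notin l0 r0 : uniq (abs_word (inorder l0 a r0)) ->
    (a, ~~ odd (size (tree_word l0))) \notin rev (tree_word l0) /\
    (a, ~~ odd (size (tree_word l0))) \notin tree_word r0.
  move=> /map_uniq; rewrite cat_uniq /= negb_or => /and3P[_ /andP[-> _]].
  by case/andP.
have [n1 _] := root_notin _ _ ui1; have [n2 _] := root_notin _ _ ui2.
move/eqP: ii; rewrite /inorder odd12 in n1 n2 *.
rewrite eqseq_pivot2l // => /andP[/eqP/(can_inj revK) el /eqP er].
by rewrite (IHl l2) // (IHr r2).
Qed.

(** Strong induction on the length: the minimum becomes the root, and the two sides of it, after a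
    flip if its sign demands one, are again words of the required kind. *)
Lemma tree_word_surj (w : seq (nat * bool)) : uniq (abs_word w) -> alternating false (abs_word w) ->
  exists2 t, good_tree t & tree_word t = w.
Proof.
have [m] := ubnP (size w); elim: m w => // m IHm w wm uw altw.
have [->|w0] := eqVneq w [::]; first by exists Empty.
have perml : perm_eq (letters w) w by apply/permEl/perm_sort.
(* The head [p] of the sorted letters is the future root. *)
case lw: (letters w) perml => [|p w1] perml.
  by case: w {wm uw altw lw} w0 perml => // x w _ /perm_size.
have pmin : all (ltn p.1) (abs_word w1).
  have := letters_abs_sorted uw; rewrite lw /= path_sortedE; first by case/andP.
  exact: ltn_trans.
have [wa|wa] := eqVneq w [:: (p.1, false)]; first by exists (Leaf p.1).
pose w' := if p.2 then flip w else w.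
have pw' : perm_eq w' w.
  by rewrite /w'; case: ifP => // _; apply/flip_perm/(map_uniq uw).
have altw' : alternating p.2 (abs_word w').
  by rewrite /w'; case: ifP => //; rewrite flip_alternating.
have ww' : w = if p.2 then flip w' else w'.
  by rewrite /w'; case: (p.2) => //; rewrite flipK // (map_uniq uw).
have : p \in w' by rewrite (perm_mem pw') -(perm_mem perml) mem_head.
move: pw' altw' ww'; move: w' => w' pw' altw' ww' /path.splitPr pw2.
case: pw2 pw' altw' ww' => v1 v2 pw' altw' ww'.
have perm1 : perm_eq (rev v1 ++ v2) w1.
  rewrite -(perm_cons p); rewrite perm_sym in perml.
  apply: perm_trans perml; apply: perm_trans pw'; rewrite perm_sym.
  by rewrite -[p :: v2]cat1s perm_catCA /= perm_cons perm_cat // perm_sym perm_rev.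
have : all (ltn p.1) (abs_word (rev v1 ++ v2)).
  by rewrite (perm_all _ (perm_map _ perm1)).
rewrite map_cat all_cat => /andP[pv1 pv2].
have : uniq (abs_word (rev v1 ++ v2)).
  rewrite (perm_uniq (perm_map _ perm1)); move: uw.
  by rewrite -(perm_uniq (perm_map _ perml)) => /andP[].
rewrite map_cat => uv; move: (uv); rewrite cat_uniq => /and3P[uv1 _ uv2].
have sz : size (rev v1 ++ v2) < m.
  by rewrite (perm_size perm1) -ltnS (leq_trans _ wm) // -(perm_size perml).
rewrite size_cat in sz.
move: altw'; rewrite -(revK v1) map_cat map_rev /= alternating_pivot //.
case/and3P=> dir altv1 altv2.
have [l gl el] := IHm (rev v1) (leq_ltn_trans (leq_addr _ _) sz) uv1 altv1.
have [r gr er] := IHm v2 (leq_ltn_trans (leq_addl _ _) sz) uv2 altv2.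
(* The sign of [p] must be the one that [tree_word] will write. The direction of the word forces it,
   except for a single letter, where the sign is [true] since the leaf has been set aside. *)
have p2 : p.2 = ~~ odd (size (tree_word l)).
  rewrite el; case/orP: dir => [|/eqP]; last by rewrite size_map.
  rewrite -map_cat; case v12: (rev v1 ++ v2) => // _.
  move: v12; case: (v1) ww' => [|x v]; last by rewrite rev_cons -cats1 -catA; case: (rev v).
  case: (v2) => // ww' _; case p2: p.2 => //; rewrite p2 in ww'.
  by case/eqP: wa; rewrite ww' -p2 -surjective_pairing.
exists (Node p.1 l r).
  rewrite good_node gl gr -!all_tree_word // el er pv1 pv2 /=.
  rewrite -(perm_uniq (_ : perm_eq (abs_word (rev v1) ++ abs_word v2) _)) //.
  by rewrite perm_cat // -?el -?er tree_word_labels.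
rewrite tree_word_nodeE /inorder -p2 el er revK -surjective_pairing.
by rewrite -(negbK (odd _)) -el -p2 if_neg -ww'.
Qed.

(** * The rightmost path of a tree as a list of cycle words *)

Definition first_abs (c : seq (nat * bool)) := (head (0, false) c).1.

Definition cycle_word (c : seq (nat * bool)) :=
  if c is (a, b) :: w then
    [&& ~~ b, all (ltn a) (abs_word w) & alternating true (abs_word c)]
  else false.

(* The common code of the two families: the chosen cycles of a signed
   permutation, and the words of the left subtrees hanging off the rightmost
   path of a tree. *)
Definition cycle_code n k (cs : seq (seq (nat * bool))) :=
  [&& perm_eq (k :: abs_word (flatten cs)) (iota 1 n), all cycle_word cs
    & sorted ltn (rcons (map first_abs cs) k)].

(** The rightmost leaf is left out: its label is the parameter [k] of [cycle_code]. The sign [false]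
    on [a] reflects that a chosen cycle starts with a positive entry. *)
Fixpoint spine (t : bintree) : seq (seq (nat * bool)) :=
  if t is Node a l r then ((a, false) :: tree_word l) :: spine r else [::].

Definition rightmost_label t := root_label (rightmost_leaf t).

Lemma rightmost_label_node a l r :
  rightmost_label (Node a l r) = rightmost_label r.
Proof. by rewrite /rightmost_label /rightmost_leaf /=; case: r. Qed.

(** The ascent from the minimum [a] is automatic, so only the alternation of [w] remains, starting
    with a descent. *)
Lemma cycle_wordE a w : cycle_word ((a, false) :: w) =
  all (ltn a) (abs_word w) && alternating false (abs_word w).
Proof.
rewrite /cycle_word map_cons; case aw: (all _ _) => //.
by rewrite alternating_min // orbT.
Qed.

Lemma spine_labels t k : good_tree t -> rightmost_label t = Some k ->
  perm_eq (k :: abs_word (flatten (spine t))) (labels t).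
Proof.
elim: t => [|a|a l IHl r IHr] //; first by move=> _ [->].
rewrite good_node rightmost_label_node => /and5P[al ar gl gr ulr] rk.
have /seq.permP pr := IHr gr rk; have /seq.permP pl := tree_word_labels gl.
apply/seq.permP => P; move: (pr P) (pl P).
by rewrite /= map_cat !count_cat /= => <- <-; lia.
Qed.

Lemma spine_cycle_word t : good_tree t -> all cycle_word (spine t).
Proof.
elim: t => [|a|a l IHl r IHr] //.
rewrite good_node => /and5P[al ar gl gr ulr].
apply/andP; split; last exact: IHr.
by rewrite cycle_wordE all_tree_word // al tree_word_alternating.
Qed.

Lemma sub_first_abs cs : all cycle_word cs ->
  {subset map first_abs cs <= abs_word (flatten cs)}.
Proof.
elim: cs => //= -[|[a b] w] cs IHcs //= /andP[_ /IHcs sub] x.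
by rewrite !inE map_cat mem_cat => /orP[->|/sub ->]; rewrite ?orbT.
Qed.

Lemma spine_sorted t k : good_tree t -> rightmost_label t = Some k ->
  sorted ltn (rcons (map first_abs (spine t)) k).
Proof.
elim: t => [|a|a l IHl r IHr] //.
rewrite good_node rightmost_label_node => /and5P[al ar gl gr ulr] rk.
rewrite /= path_sortedE ?IHr ?andbT //; last exact: ltn_trans.
apply/allP => x xr; apply: (allP ar); rewrite -(perm_mem (spine_labels gr rk)).
move: xr; rewrite mem_rcons !inE => /predU1P[->|xr]; first by rewrite eqxx.
by rewrite (sub_first_abs (spine_cycle_word gr)) ?orbT.
Qed.

(** The spine determines everything but the rightmost leaf, which the rightmost label supplies. *)
Lemma spine_inj t1 t2 : good_tree t1 -> good_tree t2 ->
  rightmost_label t1 != None -> rightmost_label t1 = rightmost_label t2 ->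
  spine t1 = spine t2 -> t1 = t2.
Proof.
elim: t1 t2 => [|a|a l IHl r IHr] [|a2|a2 l2 r2] //; first by move=> _ _ _ [->].
rewrite !good_node !rightmost_label_node => /and5P[_ _ gl gr _] /and5P[_ _ gl2 gr2 _].
move=> r0 rr2 [-> el er]; rewrite (tree_word_inj gl gl2 el).
by rewrite (IHr r2).
Qed.

(** The heads increase up to [k] and each head is minimal in its own cycle. This is what allows the
    first head to be placed above all later labels in the tree. *)
Lemma cycle_code_first_abs_min c cs k x :
  all cycle_word (c :: cs) -> sorted ltn (rcons (map first_abs (c :: cs)) k) ->
  x \in k :: abs_word (flatten cs) -> first_abs c < x.
Proof.
move=> /andP[_ wcs]; rewrite /= path_sortedE; last exact: ltn_trans.
case/andP=> /allP lt_c _; rewrite inE => /predU1P[->|].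
  by apply: lt_c; rewrite mem_rcons mem_head.
case/mapP=> y /flattenP[d dcs yd] ->.
have := lt_c (first_abs d); rewrite mem_rcons inE map_f ?orbT // => /(_ isT) lt_cd.
apply: leq_trans lt_cd _; have := allP wcs _ dcs.
case: d yd {dcs} => [|[a b] w] //; rewrite inE => /predU1P[->|yw] //.
by case/and3P=> _ /allP lt_a _; apply/ltnW/lt_a/map_f.
Qed.

(** The path is rebuilt from the leaf [k] upward: a cycle with head [a] and rest [w] adds a node [a]
    whose left subtree has word [w]. *)
Lemma spine_surj k cs : uniq (k :: abs_word (flatten cs)) -> all cycle_word cs ->
  sorted ltn (rcons (map first_abs cs) k) ->
  exists t, [/\ good_tree t, spine t = cs & rightmost_label t = Some k].
Proof.
elim: cs => [|c cs IHcs] u wcs srt; first by exists (Leaf k).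
have lt_c := cycle_code_first_abs_min wcs srt.
case: c => [|[a b] w] // in wcs srt u lt_c *.
case/andP: wcs => wc wcs; have b0 : b = false by case/and3P: wc => /negPf.
move: wc; rewrite {}b0 cycle_wordE in srt u lt_c * => /andP[aw altw].
have {u} : uniq (abs_word w ++ k :: abs_word (flatten cs)).
  have : perm_eq (abs_word w ++ k :: abs_word (flatten cs))
                 (k :: abs_word w ++ abs_word (flatten cs)).
    by rewrite -cat1s perm_catCA.
  move/perm_uniq->; move: u; rewrite /= map_cat inE !negb_or.
  by case/andP=> /andP[_ ->] /andP[_ ->].
move=> u; move: (u); rewrite cat_uniq => /and3P[uw _ uk].
have [|r [gr er rk]] := IHcs uk wcs; first by move: srt => /path_sorted.
have [l gl el] := tree_word_surj uw altw.
exists (Node a l r); rewrite rightmost_label_node /= el er; split=> //.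
rewrite good_node gl gr -all_tree_word // el aw /= -(perm_all _ (spine_labels gr rk)) er.
apply/andP; split; first by apply/allP.
have := perm_cat (tree_word_labels gl) (spine_labels gr rk).
by move/perm_uniq <-; rewrite el er.
Qed.

Lemma is_TE n t : is_T n t = perm_eq (labels t) (iota 1 n) && good_tree t.
Proof.
rewrite /is_T /good_tree; case pl: (perm_eq _ _) => //=.
by rewrite (perm_uniq pl) iota_uniq andbT.
Qed.

Lemma is_Tstar_atE n k t : is_Tstar_at n k t =
  [&& perm_eq (labels t) (iota 1 n), good_tree t & rightmost_label t == Some k].
Proof.
rewrite /is_Tstar_at /is_Tstar is_TE -/(rightmost_label t).
by case: (rightmost_label t) => [x|]; rewrite ?andbF ?andbT -?andbA.
Qed.

Lemma spine_code n k t : is_Tstar_at n k t -> cycle_code n k (spine t).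
Proof.
rewrite is_Tstar_atE => /and3P[pl gt /eqP tk].
rewrite /cycle_code spine_cycle_word // spine_sorted // (perm_trans _ pl) //.
exact: spine_labels.
Qed.

Lemma code_spine n k cs :
  cycle_code n k cs -> exists2 t, is_Tstar_at n k t & spine t = cs.
Proof.
case/and3P=> pcs wcs srt.
have [|t [gt et tk]] := spine_surj _ wcs srt.
  by rewrite (perm_uniq pcs) iota_uniq.
exists t => //; rewrite is_Tstar_atE gt tk eqxx andbT.
by rewrite perm_sym (perm_trans _ (spine_labels gt tk)) // et perm_sym.
Qed.

(** * Signed permutations as lists of cycles *)

Section SignedPermutations.
Variable n : nat.
Implicit Types (s : {perm letter n}) (x y z : letter n) (i : 'I_n).

Lemma barK : involutive (@bar n).
Proof. by case=> i b; rewrite /bar /= negbK. Qed.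

Lemma bar_neq x : bar x != x.
Proof. by case: x => i b; rewrite /bar xpair_eqE /= eqxx; case: b. Qed.

Lemma eq_abs x y : x.1 = y.1 -> y = x \/ y = bar x.
Proof.
case: x y => [i a] [j b] /= ->; rewrite /bar /=.
by case: a; case: b; [left | right | right | left].
Qed.

Lemma absl_inj x y : absl x = absl y -> x.1 = y.1.
Proof. by move=> [] /val_inj. Qed.

Lemma mem_bar_set (C : {set letter n}) x : (x \in bar_set C) = (bar x \in C).
Proof.
apply/imsetP/idP => [[y yC ->]|xC]; first by rewrite barK.
by exists (bar x); rewrite ?barK.
Qed.

Lemma mem_special i x : (x \in [set pos i; bar (pos i)]) = (x.1 == i).
Proof. by case: x => j b; rewrite !inE /bar !xpair_eqE /=; case: b; rewrite ?andbT ?andbF ?orbF. Qed.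

Lemma signed_bar s x : signed_perm s -> s (bar x) = bar (s x).
Proof. by move/forallP/(_ x)/eqP. Qed.

Lemma porbit_bar s x : signed_perm s -> porbit s (bar x) = bar_set (porbit s x).
Proof.
move=> ss; have exp_bar k y : (s ^+ k)%g (bar y) = bar ((s ^+ k)%g y).
  by rewrite !permX; elim: k => //= k ->; rewrite signed_bar.
apply/setP => y; rewrite mem_bar_set.
apply/porbitP/porbitP => -[k e]; exists k.
  by rewrite e exp_bar barK.
by rewrite exp_bar -e barK.
Qed.

Definition self_barred s x := porbit s x == bar_set (porbit s x).

Lemma porbit_eq s x y : y \in porbit s x -> porbit s y = porbit s x.
Proof. by rewrite -eq_porbit_mem => /eqP. Qed.

Lemma self_barred_mem s x y : y \in porbit s x -> self_barred s y = self_barred s x.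
Proof. by rewrite /self_barred => /porbit_eq ->. Qed.

Lemma self_barredE s x : signed_perm s -> self_barred s x = (bar x \in porbit s x).
Proof. by move=> ss; rewrite /self_barred -porbit_bar // eq_sym eq_porbit_mem. Qed.

Lemma special_self_barred s i : special_cycle s i.+1 ->
  forall x, self_barred s x = (x.1 == i).
Proof.
case/existsP=> j /andP[/eqP[/val_inj ->] /eqP/setP specE] x.
have barredE C : C \in porbits s -> (C == bar_set C) = (C == [set pos i; bar (pos i)]).
  by move=> Cs; have := specE C; rewrite !inE Cs.
rewrite -mem_special /self_barred barredE ?imset_f //.
apply/eqP/idP => [<-|xD]; first exact: porbit_id.
have /imsetP[y _ Dy] : [set pos i; bar (pos i)] \in porbits s.
  by have := specE [set pos i; bar (pos i)]; rewrite !inE eqxx => /andP[].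
by rewrite Dy in xD *; apply: porbit_eq.
Qed.

Lemma special_at s i x : signed_perm s -> special_cycle s i.+1 -> x.1 = i -> s x = bar x.
Proof.
move=> ss sp xi; have sb := special_self_barred sp.
have sx : self_barred s (s x).
  by rewrite (self_barred_mem (mem_porbit s 1 x)) sb xi.
have [e|e] : s x = x \/ s x = bar x by apply: eq_abs; move: sx; rewrite sb xi => /eqP.
  (* If [x] were fixed, its orbit would consist of [x] alone and could not contain [bar x]. *)
  have : bar x \in porbit s x by rewrite -self_barredE // sb xi.
  case/porbitP=> k; rewrite permX.
  have -> : iter k s x = x by elim: k => //= k ->.
  by move/eqP; rewrite (negPf (bar_neq x)).
exact: e.
Qed.

Lemma cycle_from_mem s x : cycle_from s x =i porbit s x.
Proof. by move=> y; rewrite porbit_traject. Qed.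

Lemma cycle_from_cons s x :
  cycle_from s x = x :: traject s (s x) #|porbit s x|.-1.
Proof.
have : 0 < #|porbit s x| by apply/card_gt0P; exists x; apply: porbit_id.
by rewrite /cycle_from; case: #|_|.
Qed.

Lemma mem_firsts s x : (x \in firsts s) = ~~ x.2 && is_first s x.
Proof.
rewrite mem_filter andbC; congr (_ && _).
apply/mapP/idP => [[i _ ->] //|]; case: x => i [] // _.
by exists i; rewrite ?mem_enum.
Qed.

Lemma firsts_sorted s : sorted ltn (map (@absl n) (firsts s)).
Proof.
rewrite sorted_map; apply: sorted_filter.
  by move=> y x z /=; apply: ltn_trans.
rewrite sorted_map; have := iota_ltn_sorted 0 n.
by rewrite -val_enum_ord sorted_map.
Qed.

(** A cycle containing both [y] and [bar y] is its own opposite. *)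
Lemma porbit_abs_inj s x : signed_perm s -> ~~ self_barred s x ->
  {in porbit s x &, forall y z, y.1 = z.1 -> y = z}.
Proof.
move=> ss nsx y z yx zx /eq_abs[//|zy]; case/negP: nsx.
by rewrite -(self_barred_mem yx) self_barredE // -zy (porbit_eq yx).
Qed.

(** Equal absolute values put the two entries in the same cycle or in opposite ones. In the first
    case the positive minimal entries agree. In the second they agree as well, and the cycle would
    be its own opposite, which is excluded. *)
Lemma firsts_disjoint s x1 x2 y1 y2 : signed_perm s ->
  x1 \in firsts s -> x2 \in firsts s ->
  y1 \in porbit s x1 -> y2 \in porbit s x2 -> y1.1 = y2.1 -> x1 = x2 /\ y1 = y2.
Proof.
move=> ss; rewrite !mem_firsts.
move=> /and3P[p1 n1 /forall_inP min1] /and3P[p2 n2 /forall_inP min2] yx1 yx2 ey.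
have eqx : x1.1 = x2.1 -> x1 = x2.
  by case: (x1) (x2) p1 p2 => [i1 []] [i2 []] //= _ _ ->.
have [e|e] := eq_abs ey; rewrite e in yx2.
  have o12 : porbit s x1 = porbit s x2 by rewrite -(porbit_eq yx1) (porbit_eq yx2).
  split=> //; apply/eqx/absl_inj/anti_leq/andP; split.
    by apply: min1; rewrite o12 porbit_id.
  by apply: min2; rewrite -o12 porbit_id.
have o12 : porbit s x2 = porbit s (bar x1).
  by rewrite -(porbit_eq yx2) !porbit_bar // (porbit_eq yx1).
have x12 : x1 = x2.
  apply/eqx/absl_inj/anti_leq/andP; split.
    apply: (min1 (bar x2)); rewrite -mem_bar_set -porbit_bar // -o12.
    exact: porbit_id.
  by apply: (min2 (bar x1)); rewrite o12 porbit_id.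
by case/negP: n1; rewrite -porbit_bar // -o12 x12.
Qed.

(** The entry of smallest absolute value in the cycle of [y], or its negative, is the positive entry
    that starts the chosen cycle of the pair. *)
Lemma firsts_cover s y : signed_perm s -> ~~ self_barred s y ->
  exists2 x, x \in firsts s & (y \in porbit s x) || (bar y \in porbit s x).
Proof.
move=> ss nsy; case: (arg_minnP (@absl n) (porbit_id s y)) => x xy minx.
have oxy := porbit_eq xy; have nsx : ~~ self_barred s x by rewrite (self_barred_mem xy).
case x2: (x.2); last first.
  exists x; last by rewrite oxy porbit_id.
  rewrite mem_firsts x2 /is_first [_ != _]nsx /=.
  by apply/forall_inP => z; rewrite oxy => /minx.
have oxb := porbit_bar x ss.
exists (bar x); last by rewrite oxb !mem_bar_set barK oxy porbit_id orbT.
rewrite mem_firsts /= x2 /is_first /=; apply/andP; split.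
  move: nsx; rewrite !self_barredE // -[_ == _]/(self_barred s (bar x)) self_barredE //.
  by rewrite oxb mem_bar_set barK.
by apply/forall_inP => z; rewrite oxb mem_bar_set oxy => /minx.
Qed.

Definition unbound x : nat * bool := (absl x, x.2).

Lemma unbound_inj : injective unbound.
Proof. by move=> [i a] [j b] [/val_inj -> ->]. Qed.

Definition perm_code s := map (map unbound) (chosen_cycles s).

Lemma perm_code_abs s :
  abs_word (flatten (perm_code s)) = map (@absl n) (flatten (chosen_cycles s)).
Proof. by rewrite -map_flatten -map_comp. Qed.

Lemma flatten_uniq (T U : eqType) (f : T -> seq U) (r : seq T) :
  uniq r -> {in r, forall a, uniq (f a)} ->
  {in r &, forall a b u, u \in f a -> u \in f b -> a = b} ->
  uniq (flatten (map f r)).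
Proof.
elim: r => //= a r IHr /andP[ar ur] uf disj; rewrite cat_uniq uf ?mem_head //=.
rewrite IHr //; first last.
- by move=> b c br cr; apply: disj; rewrite inE ?br ?cr orbT.
- by move=> b br; apply: uf; rewrite inE br orbT.
rewrite andbT; apply/hasPn => u /flatten_mapP[b br ub]; apply/negP => ua.
by case/negP: ar; rewrite (disj a b _ _ u) ?mem_head // inE br orbT.
Qed.

Lemma mem_chosen s y :
  reflect (exists2 x, x \in firsts s & y \in porbit s x)
          (y \in flatten (chosen_cycles s)).
Proof.
by apply: (iffP flatten_mapP) => -[x xs yx]; exists x => //;
  rewrite cycle_from_mem in yx *.
Qed.

(** Each absolute value other than [i.+1] occurs once in the chosen cycles: at least once by
    [firsts_cover], at most once by [firsts_disjoint]. *)
Lemma perm_code_perm s i : signed_perm s -> special_cycle s i.+1 ->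
  perm_eq (i.+1 :: abs_word (flatten (perm_code s))) (iota 1 n).
Proof.
move=> ss sp; have sb := special_self_barred sp.
apply: uniq_perm (iota_uniq 1 n) _.
  rewrite perm_code_abs /= map_inj_in_uniq; last first.
    move=> y z /mem_chosen[x1 x1s yx1] /mem_chosen[x2 x2s zx2] /absl_inj yz.
    by have [] := firsts_disjoint ss x1s x2s yx1 zx2 yz.
  apply/andP; split.
    apply/mapP => -[y /mem_chosen[x xs yx] [/val_inj iy]].
    move: xs; rewrite mem_firsts => /and3P[_ /negP nsx _]; apply: nsx.
    by rewrite -[_ == _]/(self_barred s x) -(self_barred_mem yx) sb iy.
  apply: flatten_uniq.
  - by apply: (@map_uniq _ _ (@absl n)); apply: sorted_uniq (firsts_sorted s);
      [exact: ltn_trans | exact: ltnn].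
  - by move=> x _; apply: uniq_traject_porbit.
  move=> x1 x2 x1s x2s y; rewrite !cycle_from_mem => yx1 yx2.
  by have [] := firsts_disjoint ss x1s x2s yx1 yx2 erefl.
move=> a; rewrite mem_iota perm_code_abs inE; apply/idP/idP.
  by rewrite add1n ltnS; case/predU1P=> [->|/mapP[y _ ->]]; apply: ltn_ord.
case: a => // a; rewrite add1n /= => an; pose j := @Ordinal n a an.
have [ji|ji] := eqVneq j i; first by rewrite -ji eqxx.
have [|x xs] := @firsts_cover s (pos j) ss; first by rewrite sb.
by case/orP=> yx; apply/orP; right; apply/mapP; [exists (pos j) | exists (bar (pos j))];
  rewrite //; apply/mem_chosen; exists x.
Qed.

Lemma perm_codeP s i : is_CUDD_at i.+1 s -> cycle_code n i.+1 (perm_code s).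
Proof.
case/and4P=> ss sp bound alt; rewrite /cycle_code perm_code_perm //=.
apply/andP; split.
  rewrite all_map; apply/allP => c cs /=.
  have := allP alt _ cs; case/mapP: cs => x; rewrite mem_firsts.
  case/and3P=> /negPf x2 nsx /forall_inP minx ->.
  have := uniq_traject_porbit s x; rewrite -/(cycle_from s x).
  have := cycle_from_mem s x.
  rewrite cycle_from_cons => memc /andP[nx _] altc.
  rewrite map_cons /cycle_word {1}/unbound x2 /=; apply/andP; split.
    rewrite -map_comp all_map; apply/allP => y yt /=.
    have yx : y \in porbit s x by rewrite -memc inE yt orbT.
    (* The minimum is strict because a cycle that is not its own opposite has distinct absolute
       values. *)
    rewrite ltn_neqAle minx // andbT; apply/eqP => /absl_inj e; case/negP: nx.
    by rewrite {1}(porbit_abs_inj ss nsx (porbit_id s x) yx e).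
  by move: altc; rewrite /= -map_comp.
have -> : map first_abs (perm_code s) = map (@absl n) (firsts s).
  rewrite -!map_comp; apply: eq_map => x /=.
  by rewrite cycle_from_cons.
move: bound (firsts_sorted s); case: (map _ _) => //= a r ak.
by rewrite rcons_path => ->.
Qed.

(** The chosen cycles fix the values on their own entries, compatibility with [bar] fixes them on
    the opposite cycles, and the special cycle is known from [i]. *)
Lemma perm_code_inj s1 s2 i :
  is_CUDD_at i.+1 s1 -> is_CUDD_at i.+1 s2 -> perm_code s1 = perm_code s2 -> s1 = s2.
Proof.
case/and4P=> ss1 sp1 _ _ /and4P[ss2 sp2 _ _].
move/(inj_map (inj_map unbound_inj)) => chosen12.
have next_from s x y : y \in porbit s x -> next (cycle_from s x) y = s y.
  rewrite -cycle_from_mem => yx; apply/esym/eqP.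
  apply: (@next_cycle _ (frel s)) => //; rewrite cycle_from_cons /=.
  have := iter_porbit s x; have : 0 < #|porbit s x|.
    by apply/card_gt0P; exists x; apply: porbit_id.
  case: #|_| => // m _ e.
  by rewrite rcons_path fpath_traject last_traject /=; apply/eqP.
have agree y x : x \in firsts s1 -> y \in porbit s1 x -> s1 y = s2 y.
  move=> xs yx; have : cycle_from s1 x \in chosen_cycles s2.
    by rewrite -chosen12 map_f.
  case/mapP=> x2 _ e; rewrite -(next_from _ _ _ yx) e next_from //.
  by rewrite -cycle_from_mem -e cycle_from_mem.
apply/permP => y; have [yi|yi] := eqVneq y.1 i.
  by rewrite !(special_at _ _ yi).
have [|x xs /orP[yx|yx]] := @firsts_cover s1 y ss1.
- by rewrite (special_self_barred sp1).
- exact: agree yx.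
- by apply: (can_inj barK); rewrite -!signed_bar //; apply: agree yx.
Qed.

End SignedPermutations.

(** * Permutations with a prescribed list of cycles *)

Section CyclesNext.
Variable T : finType.
Implicit Types (A : seq (seq T)) (c : seq T) (s : {perm T}).

(** When the lists in [A] are duplicate-free, disjoint and cover [T], this is the permutation with
    these cycles. *)
Definition cycles_next A x := next (nth [::] A (find (fun c => x \in c) A)) x.

Lemma flatten_uniq_eq A c d x :
  uniq (flatten A) -> c \in A -> d \in A -> x \in c -> x \in d -> c = d.
Proof.
elim: A => //= e A IHA; rewrite cat_uniq => /and3P[_ /hasPn disj uA].
have notin f : f \in A -> x \in e -> x \notin f.
  by move=> fA; apply: contraL => xf; apply: disj; apply/flattenP; exists f.
rewrite !inE => /predU1P[->|cA] /predU1P[->|dA] // xc xd; last exact: IHA.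
- by rewrite (negPf (notin _ dA xc)) in xd.
- by rewrite (negPf (notin _ cA xd)) in xc.
Qed.

Lemma cycles_nextE A c x :
  uniq (flatten A) -> c \in A -> x \in c -> cycles_next A x = next c x.
Proof.
move=> uA cA xc; have hasx : has (fun d => x \in d) A by apply/hasP; exists c.
congr next; apply: (flatten_uniq_eq uA (x := x)) => //.
  by rewrite mem_nth // -has_find.
exact: (nth_find [::] hasx).
Qed.

Lemma uniq_in_flatten A c : uniq (flatten A) -> c \in A -> uniq c.
Proof.
elim: A => //= d A IHA; rewrite cat_uniq inE => /and3P[ud _ uA].
by case/predU1P=> [->|/IHA->].
Qed.

(** The image of [x] stays in the list of [x], so two letters with the same image share a list, on
    which [prev] inverts [next]. *)
Lemma cycles_next_inj A :
  uniq (flatten A) -> (forall x, x \in flatten A) -> injective (cycles_next A).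
Proof.
move=> uA cover x y.
have /flattenP[c cA xc] := cover x; have /flattenP[d dA yd] := cover y.
rewrite (cycles_nextE uA cA xc) (cycles_nextE uA dA yd) => e.
have cd : c = d.
  by apply: (flatten_uniq_eq uA cA dA (x := next c x)); [|rewrite e]; rewrite mem_next.
rewrite -{d}cd in dA yd e.
by rewrite -(prev_next (uniq_in_flatten uA cA) x) e prev_next // (uniq_in_flatten uA cA).
Qed.

(** This identifies a prescribed list with what [cycle_from] writes when started at its head. *)
Lemma next_traject s x p (c := x :: p) : uniq c -> {in c, s =1 next c} ->
  c = traject s x #|porbit s x| /\ porbit s x =i c.
Proof.
move=> uc sc.
have : fcycle s c.
  apply: (@sub_in_cycle _ (mem c) (frel (next c))); last exact: cycle_next.
    by move=> y z yc zc /= /eqP <-; rewrite sc.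
  exact/allP.
rewrite /= rcons_path => /andP[/fpathP[m pm] _].
have ctraj : c = traject s x m.+1 by rewrite /c pm.
have orb : porbit s x =i c.
  move=> y; apply/idP/idP.
    case/porbitP=> k ->; rewrite permX; elim: k => [|k IHk] /=; first exact: mem_head.
    by rewrite sc // mem_next.
  by rewrite ctraj => /trajectP[k _ ->]; rewrite -permX mem_porbit.
split=> //; rewrite (eq_card orb) (card_uniqP uc).
by rewrite (_ : size c = m.+1) // ctraj size_traject.
Qed.

Lemma next_porbit s c x : uniq c -> {in c, s =1 next c} -> x \in c ->
  porbit s x =i c.
Proof.
move=> uc sc xc y; have [k p rotc] := rot_to xc.
have [||_ ->] := @next_traject s x p.
- by rewrite -rotc rot_uniq.
- by move=> z; rewrite -rotc mem_rot => zc; rewrite next_rot // sc.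
by rewrite -rotc mem_rot.
Qed.

End CyclesNext.

(** * The signed permutation with prescribed chosen cycles *)

Section Decode.
Variables (n : nat) (i : 'I_n) (cs : seq (seq (letter n))).
Let L := flatten cs.
Hypothesis abs_perm : perm_eq (i.+1 :: map (@absl n) L) (iota 1 n).
Hypothesis cycle_words : all cycle_word (map (map (@unbound n)) cs).
Hypothesis heads_sorted :
  sorted ltn (rcons (map first_abs (map (map (@unbound n)) cs)) i.+1).
Implicit Types x y z : letter n.

Let abs_uniq : uniq (map (@absl n) L).
Proof. by have := iota_uniq 1 n; rewrite -(perm_uniq abs_perm) => /andP[]. Qed.

Let L_uniq : uniq L. Proof. exact: map_uniq abs_uniq. Qed.

Let L_abs_inj : {in L &, forall x y, x.1 = y.1 -> x = y}.
Proof.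
move=> x y xL yL e; have e' : absl x = absl y by rewrite /absl e.
have ix : index x L < size L by rewrite index_mem.
have iy : index y L < size L by rewrite index_mem.
apply: (index_inj x xL yL) => /=; apply/eqP.
rewrite -(nth_uniq 0 _ _ abs_uniq) ?size_map //.
by rewrite !(nth_map x) // !nth_index // e'.
Qed.

Let L_special x : x \in L -> x.1 != i.
Proof.
move=> xL; apply/eqP => xi; have := iota_uniq 1 n; rewrite -(perm_uniq abs_perm).
by case/andP=> /negP[]; rewrite -xi -[_.+1]/(absl x) map_f.
Qed.

Let L_bar x : x \in L -> bar x \notin L.
Proof.
move=> xL; apply/negP => bL; have := L_abs_inj xL bL erefl.
by move/esym/eqP; rewrite (negPf (bar_neq x)).
Qed.

Let special := [:: pos i; bar (pos i)].
(** Adding the opposite cycles and the special one makes the lists partition all letters, so that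
    [cycles_next] yields a permutation. *)
Let A := special :: cs ++ map (map (@bar n)) cs.

Let flatten_A : flatten A = special ++ L ++ map (@bar n) L.
Proof. by rewrite /A /= flatten_cat -map_flatten. Qed.

Let mem_barL x : (x \in map (@bar n) L) = (bar x \in L).
Proof. by rewrite -{1}[x]barK mem_map //; apply: can_inj (@barK n). Qed.

Let specialE x : (x \in special) = (x.1 == i).
Proof. by rewrite -mem_special !inE. Qed.

Let A_uniq : uniq (flatten A).
Proof.
rewrite flatten_A cat_uniq; apply/and3P; split.
- by rewrite /special /= inE eq_sym bar_neq.
- apply/hasPn => x; rewrite specialE mem_cat mem_barL.
  by case/orP=> /L_special.
rewrite cat_uniq L_uniq map_inj_uniq ?L_uniq ?andbT /=; last exact: can_inj (@barK n).
by apply/hasPn => x; rewrite mem_barL => /L_bar; rewrite barK.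
Qed.

Let A_cover x : x \in flatten A.
Proof.
rewrite flatten_A !mem_cat specialE mem_barL; have [//|xi /=] := eqVneq.
have : absl x \in i.+1 :: map (@absl n) L.
  by rewrite (perm_mem abs_perm) mem_iota add1n /= ltnS; apply: ltn_ord.
rewrite inE => /predU1P[[/val_inj e]|/mapP[y yL /absl_inj e]].
  by rewrite e eqxx in xi.
by have [<-|<-] := eq_abs e; rewrite yL ?orbT.
Qed.

Let s := perm (cycles_next_inj A_uniq A_cover).

Let s_next c : c \in A -> {in c, s =1 next c}.
Proof. by move=> cA x xc; rewrite permE (cycles_nextE A_uniq cA xc). Qed.

Let special_A : special \in A. Proof. exact: mem_head. Qed.

Let cs_A c : c \in cs -> c \in A.
Proof. by move=> ccs; rewrite inE mem_cat ccs orbT. Qed.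

Let bar_A c : c \in cs -> map (@bar n) c \in A.
Proof. by move=> ccs; rewrite inE mem_cat (map_f (map _) ccs) !orbT. Qed.

Let s_porbit c x : c \in A -> x \in c -> porbit s x =i c.
Proof. by move=> cA; apply: next_porbit (s_next cA); apply: uniq_in_flatten cA. Qed.

Let A_cases x : [\/ x.1 = i, exists2 c, c \in cs & x \in c
                  | exists2 c, c \in cs & bar x \in c].
Proof.
have := A_cover x; rewrite flatten_A !mem_cat specialE mem_barL.
case/or3P=> [/eqP|/flattenP[c]|/flattenP[c]]; first by constructor 1.
- by constructor 2; exists c.
- by constructor 3; exists c.
Qed.

Let s_special x : x.1 = i -> s x = bar x.
Proof.
move=> xi; have xs : x \in special by rewrite specialE xi.
rewrite (s_next special_A xs); move: xs; rewrite !inE => /orP[]/eqP->.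
  by rewrite /= eqxx.
by rewrite /= (negPf (bar_neq _)) eqxx barK.
Qed.

Let s_bar_cs c x : c \in cs -> x \in c -> s (bar x) = bar (s x).
Proof.
move=> ccs xc; have bi := can_inj (@barK n).
rewrite (s_next (bar_A ccs)) ?mem_map // (s_next (cs_A ccs)) // next_map //.
exact: uniq_in_flatten (cs_A ccs).
Qed.

Let s_signed : signed_perm s.
Proof.
apply/forallP => x; apply/eqP; case: (A_cases x) => [xi|[c ccs xc]|[c ccs xc]].
- by rewrite !s_special.
- exact: s_bar_cs xc.
- by rewrite -{2}[x]barK (s_bar_cs ccs xc) barK.
Qed.

Let s_self_barred x : self_barred s x = (x.1 == i).
Proof.
rewrite self_barredE //; case: (A_cases x) => [xi|[c ccs xc]|[c ccs xc]].
- by rewrite (s_porbit special_A) !specialE /= xi eqxx.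
- have xL : x \in L by apply/flattenP; exists c.
  rewrite (s_porbit (cs_A ccs) xc) (negPf (L_special xL)); apply/negbTE.
  by apply: contra (L_bar xL) => bc; apply/flattenP; exists c.
- have xL : bar x \in L by apply/flattenP; exists c.
  have xc' : x \in map (@bar n) c by rewrite -[x]barK map_f.
  rewrite (s_porbit (bar_A ccs) xc') -[x.1]/((bar x).1) (negPf (L_special xL)).
  apply/negbTE; rewrite mem_map; last exact: can_inj (@barK n).
  by apply: contra (L_bar xL) => bc; rewrite barK; apply/flattenP; exists c.
Qed.

Let s_special_cycle : special_cycle s i.+1.
Proof.
apply/existsP; exists i; rewrite eqxx /=; apply/eqP/setP => C; rewrite !inE.
have Di : [set pos i; bar (pos i)] = porbit s (pos i).
  by apply/setP => x; rewrite mem_special (s_porbit special_A (mem_head _ _)) specialE.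
rewrite Di; apply/andP/eqP => [[/imsetP[x _ ->]]|->]; last first.
  split; first exact: imset_f.
  by have := s_self_barred (pos i); rewrite eqxx.
rewrite -[_ == _]/(self_barred s x) s_self_barred -mem_special Di.
exact: porbit_eq.
Qed.

Let cs_cons c : c \in cs -> exists x p,
  [/\ c = x :: p, x.2 = false, {in c, forall y, absl x <= absl y}
    & alternating true (map (@absl n) c)].
Proof.
move=> ccs; have := allP cycle_words _ (map_f _ ccs).
case: c {ccs} => // x p; rewrite map_cons /cycle_word {1}/unbound.
case/and3P=> /negPf x2 /allP minx altc; exists x, p; split => //.
  move=> y; rewrite inE => /predU1P[->//|yp]; apply/ltnW/minx.
  by rewrite -map_comp; apply/mapP; exists y.
by move: altc; rewrite -map_cons -map_comp.
Qed.

Let x0 := pos i.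

Let s_cycle_from c : c \in cs -> cycle_from s (head x0 c) = c.
Proof.
move=> ccs; have [x [p [ec _ _ _]]] := cs_cons ccs; rewrite {}ec /= in ccs *.
have [||e _] := @next_traject _ s x p; last exact: esym.
  exact: uniq_in_flatten (cs_A ccs).
exact/s_next/cs_A.
Qed.

Let s_firstsE x : (x \in firsts s) = (x \in map (head x0) cs).
Proof.
rewrite mem_firsts /is_first -[_ != _]/(~~ self_barred s x) s_self_barred.
apply/and3P/mapP => [[x2 xi /forall_inP minx]|[c ccs ->]]; last first.
  have [y [p [ec y2 miny _]]] := cs_cons ccs.
  have yc : y \in c by rewrite ec mem_head.
  have -> : head x0 c = y by rewrite ec.
  rewrite y2; split=> //.
    by apply: L_special; apply/flattenP; exists c.
  by apply/forall_inP => z; rewrite (s_porbit (cs_A ccs) yc) => /miny.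
case: (A_cases x) => [e|[c ccs xc]|[c ccs xc]]; first by rewrite e eqxx in xi.
  have [y [p [ec y2 miny _]]] := cs_cons ccs.
  have yc : y \in c by rewrite ec mem_head.
  exists c => //; rewrite ec /=.
  apply: L_abs_inj; [by apply/flattenP; exists c | by apply/flattenP; exists c |].
  apply/absl_inj/anti_leq; rewrite miny // andbT minx //.
  by rewrite (s_porbit (cs_A ccs) xc).
have [y [p [ec y2 miny _]]] := cs_cons ccs.
have yc : y \in c by rewrite ec mem_head.
(* Here [x] is minimal in an opposite cycle, so [bar x] is the positive head of a prescribed one and
   [x] is negative, a contradiction. *)
have e : bar x = y.
  apply: L_abs_inj; [by apply/flattenP; exists c | by apply/flattenP; exists c |].
  apply/absl_inj/anti_leq; rewrite miny // andbT (minx (bar y)) //.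
  by rewrite (@s_porbit (map (@bar n) c)) ?bar_A // ?map_f // -[x]barK map_f.
by move: y2 x2; rewrite -e /= => /negbFE ->.
Qed.

Let heads_abs : map (@absl n) (map (head x0) cs) = map first_abs (map (map (@unbound n)) cs).
Proof.
rewrite -!map_comp; apply/eq_in_map => c /cs_cons[x [p [-> _ _ _]]].
by [].
Qed.

(** Both lists are strictly sorted by absolute value and have the same members. *)
Let s_firsts : firsts s = map (head x0) cs.
Proof.
apply: (@irr_sorted_eq _ (relpre (@absl n) ltn)).
- by move=> y x z /=; apply: ltn_trans.
- by move=> x /=; apply: ltnn.
- by rewrite -sorted_map firsts_sorted.
- rewrite -sorted_map heads_abs.
  by apply: subseq_sorted heads_sorted; [apply: ltn_trans | apply: subseq_rcons].
exact: s_firstsE.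
Qed.

Let s_chosen : chosen_cycles s = cs.
Proof.
rewrite /chosen_cycles s_firsts -map_comp -[RHS]map_id.
by apply/eq_in_map => c /s_cycle_from.
Qed.

Lemma perm_of_cycles :
  exists2 s : {perm letter n}, is_CUDD_at i.+1 s & chosen_cycles s = cs.
Proof.
exists s; last exact: s_chosen.
rewrite /is_CUDD_at s_signed s_special_cycle s_chosen /=; apply/andP; split.
  rewrite s_firsts heads_abs; move: heads_sorted.
  by case: (map _ _) => //= a r; rewrite rcons_path => /andP[].
by apply/allP => c /cs_cons[x [p []]].
Qed.

End Decode.

Lemma code_perm n (i : 'I_n) cs : cycle_code n i.+1 cs ->
  exists2 s : {perm letter n}, is_CUDD_at i.+1 s & perm_code s = cs.
Proof.
(* The ordinal [j] stands for [j + 1], hence the predecessor; the default [i] is never reached,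
   since all absolute values lie between 1 and [n]. *)
pose rebound (x : nat * bool) : letter n := (insubd i x.1.-1, x.2).
case/and3P=> pcs wcs srt.
have csK : map (map (@unbound n)) (map (map rebound) cs) = cs.
  rewrite -map_comp -[RHS]map_id; apply/eq_in_map => c ccs.
  rewrite /= -map_comp -[RHS]map_id; apply/eq_in_map => -[a b] xc.
  have : a \in iota 1 n.
    rewrite -(perm_mem pcs) inE; apply/orP; right.
    by apply/mapP; exists (a, b) => //; apply/flattenP; exists c.
  rewrite mem_iota => an; rewrite /unbound /rebound /absl /= val_insubd.
  by case: a an {xc} => //= a; rewrite add1n => an; have -> : a < n := an.
have absE : map (@absl n) (flatten (map (map rebound) cs)) = abs_word (flatten cs).
  rewrite -[in RHS]csK; move: (map (map rebound) cs) => ds.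
  by rewrite -map_flatten -map_comp.
have [|||s sC es] := @perm_of_cycles n i (map (map rebound) cs).
- by rewrite absE.
- by rewrite csK.
- by rewrite csK.
by exists s; rewrite // /perm_code es csK.
Qed.

(** * The bijection *)

Lemma is_CUDD_at_exists n k (s : {perm letter n}) :
  is_CUDD_at k s -> exists2 i : 'I_n, k = i.+1 & is_CUDD_at i.+1 s.
Proof.
move=> sC; have /and4P[_ /existsP[i /andP[/eqP ik _]] _ _] := sC.
by exists i => //; rewrite -[i.+1]/(absl (pos i)) ik.
Qed.

(** The parameter is the one number from 1 to [n] that the cycles miss; counting [k1] in both lists
    shows it. *)
Lemma cycle_code_special n k1 k2 cs :
  cycle_code n k1 cs -> cycle_code n k2 cs -> k1 = k2.
Proof.
case/and3P=> p1 _ _ /and3P[p2 _ _]; move: p1.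
rewrite perm_sym in p2; move/perm_trans/(_ p2) => p12.
have /seq.permP/(_ (pred1 k1)) := p12.
by rewrite /= eqxx => /addIn; case: eqVneq => // ->.
Qed.

(* A is finite: the choice of preimages needs no axiom. *)
Lemma same_range_bijective (A : finType) (B : Type) (X : eqType)
    (f : A -> X) (g : B -> X) :
  injective f -> injective g ->
  (forall a, exists b, g b = f a) -> (forall b, exists a, g b = f a) ->
  exists2 phi : A -> B, bijective phi & forall a, g (phi a) = f a.
Proof.
move=> finj ginj fg gf.
have [phi phiE] := fin_all_exists fg.
have gf' b : exists a, g b == f a by have [a /eqP] := gf b; exists a.
exists phi => //; exists (fun b => xchoose (gf' b)) => [a|b].
  by apply: finj; rewrite -(eqP (xchooseP (gf' (phi a)))).
by apply: ginj; rewrite phiE -(eqP (xchooseP (gf' b))).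
Qed.

Theorem theorem5p3 (n : nat) (hn : 1 <= n) :
  exists phi : CUDD n -> Tstar n,
    bijective phi /\
    forall k : nat, 1 <= k <= n ->
      bij_onto (fun s : CUDD n => is_CUDD_at k (sval s))
               (fun t : Tstar n => is_Tstar_at n k (sval t)) phi.
Proof.
(* Both maps are injective with the same range, so [phi] can be defined by [g (phi s) = f s]. *)
pose f (s : CUDD n) := perm_code (sval s); pose g (t : Tstar n) := spine (sval t).
have f_code k (s : CUDD n) : is_CUDD_at k (sval s) -> cycle_code n k (f s).
  by case/is_CUDD_at_exists=> i ->; apply: perm_codeP.
have CUDD_k (s : CUDD n) : exists i : 'I_n, is_CUDD_at i.+1 (sval s).
  exact/existsP/(svalP s).
have Tstar_k (t : Tstar n) : exists k, is_Tstar_at n k (sval t).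
  have := svalP t; rewrite /is_Tstar_at => tT; rewrite tT.
  case/andP: tT => _; case: (root_label _) => // k _; exists k; apply: eqxx.
have f_inj : injective f.
  move=> s1 s2 e; apply: val_inj.
  have [i1 C1] := CUDD_k s1; have [i2 C2] := CUDD_k s2.
  have := f_code _ _ C2; rewrite -e => /(cycle_code_special (f_code _ _ C1)) i12.
  by rewrite -i12 in C2; apply: perm_code_inj C1 C2 e.
have g_inj : injective g.
  move=> t1 t2 e; have [k1 T1] := Tstar_k t1; have [k2 T2] := Tstar_k t2.
  have := spine_code T2; rewrite -[spine _]/(g t2) -e.
  move/(cycle_code_special (spine_code T1)) => k12; rewrite -{k2}k12 in T2.
  move: T1 T2; rewrite !is_Tstar_atE => /and3P[_ gt1 /eqP r1] /and3P[_ gt2 /eqP r2].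
  have : sval t1 = sval t2 by apply: spine_inj; rewrite ?r1 ?r2.
  case: t1 t2 {e gt1 gt2 r1 r2} => [t1 T1] [t2 T2] /= t12.
  (* Once the trees are identified, the membership proofs are equalities of booleans and hence
     coincide. *)
  by case: _ / t12 T2 => T2; rewrite (bool_irrelevance T1 T2).
have tree_of s : exists t, g t = f s.
  have [i /f_code/code_spine[t tT e]] := CUDD_k s.
  by case/andP: tT => tT _; exists (exist _ t tT).
have perm_of t : exists s, g t = f s.
  have [k tT] := Tstar_k t; have tc := spine_code tT.
  have kn : k \in iota 1 n.
    by case/and3P: tc => /perm_mem<- _ _; apply: mem_head.
  case: k kn tc {tT} => [|k]; rewrite mem_iota // add1n /= => kn.
  pose i := @Ordinal n k kn; case/(@code_perm n i)=> s sC e.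
  have sD : is_CUDD s by apply/existsP; exists i.
  by exists (exist _ s sD).
have [phi phi_bij phiE] := same_range_bijective f_inj g_inj tree_of perm_of.
have phi_at k s : is_CUDD_at k (sval s) = is_Tstar_at n k (sval (phi s)).
  have [i sC] := CUDD_k s; have [j tT] := Tstar_k (phi s).
  (* Both numbers are determined by the common code of [s] and [phi s], so the special cycle matches
     the rightmost label. *)
  have ij : i.+1 = j.
    by apply: cycle_code_special (f_code _ _ sC) _; rewrite -phiE; apply: spine_code.
  apply/idP/idP => [/f_code kc|/spine_code kc].
    by rewrite -(cycle_code_special (f_code _ _ sC) kc) ij.
  by rewrite -(cycle_code_special (spine_code tT) kc) -ij.
exists phi; split=> // k _; split=> [s|s1 s2 _ _|t tT]; first by rewrite phi_at.
  exact: (bij_inj phi_bij).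
have [psi phiK psiK] := phi_bij.
by exists (psi t); rewrite ?phi_at psiK.
Qed.
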